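(* Let $1<p\le 2$ and let $\alpha,\beta\ge 0$ be real numbers. Let $E$ be a nonzero real normed space and let $\tau>0$. Then for every $x\in E$, $$\alpha\,\lVert x-C_\tau(x)\rVert+\frac{\beta}{\tau}\,\lVert C_\tau(x)\rVert^2\le K_p(\alpha,\beta)\,\tau^{1-p}\,\lVert x\rVert^p .$$ Moreover, $K_p(\alpha,\beta)$ is the smallest possible uniform constant in every nonzero real normed space: for every nonzero real normed space $E$ and every $\tau>0$, if $K\in\mathbb{R}$ satisfies $\alpha\lVert x-C_\tau(x)\rVert+\frac{\beta}{\tau}\lVert C_\tau(x)\rVert^2\le K\,\tau^{1-p}\lVert x\rVert^p$ for all $x\in E$, then $K\ge K_p(\alpha,\beta)$.
   Context: For a real normed space $E$ and $\tau>0$, radial clipping is the map $C_\tau:E\to E$ with $C_\tau(x)=x$ if $\lVert x\rVert\le\tau$ and $C_\tau(x)=\tau x/\lVert x\rVert$ if $\lVert x\rVert>\tau$. For $1<p\le 2$ put $c_p=\dfrac{(p-1)^{p-1}}{p^p}$. For $\alpha,\beta\ge 0$ define $$K_p(\alpha,\beta)=\begin{cases}\beta,&\alpha\le p\beta,\\ c_p\,\dfrac{\alpha^p}{(\alpha-\beta)^{p-1}},&\alpha>p\beta.\end{cases}$$ *)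

(* Defs.v *)
From HB Require Import structures.
From mathcomp Require Import all_boot all_order all_algebra.
From mathcomp Require Import all_classical all_reals all_analysis.

Set Implicit Arguments.
Unset Strict Implicit.
Unset Printing Implicit Defensive.

Import Order.TTheory GRing.Theory Num.Theory.
Import numFieldNormedType.Exports.

Local Open Scope ring_scope.

Definition radial_clip (R : realType) (E : normedModType R) (tau : R) (x : E)
    : E :=
  if `|x| <= tau then x else (tau / `|x|) *: x.

Definition clip_c (R : realType) (p : R) : R :=
  ((p - 1) `^ (p - 1)) / (p `^ p).

(* The powers are real powers; for 1 < p, 0 <= beta and p * beta < alpha, the
   base alpha - beta is positive. *)
Definition clip_K (R : realType) (p alpha beta : R) : R :=
  if alpha <= p * beta then beta
  else clip_c p * (alpha `^ p / (alpha - beta) `^ (p - 1)).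

(* Main.v *)
Require Import Defs.
From HB Require Import structures.
From mathcomp Require Import all_boot all_order all_algebra.
From mathcomp Require Import all_classical all_reals all_analysis.
From mathcomp Require Import ring lra.

Set Implicit Arguments.
Unset Strict Implicit.
Unset Printing Implicit Defensive.

Import Order.TTheory GRing.Theory Num.Theory.
Import numFieldNormedType.Exports.

Local Open Scope ring_scope.

(** Both sides of the inequality depend on [x] only through [s = |x| / tau]: a
    factor [tau] splits off, the left side becomes [clip_profile alpha beta s],
    and the right side becomes [K * s `^ p].  A nonzero space has vectors of
    every nonnegative norm, so the best constant is the supremum over [s > 0] of
    [clip_profile alpha beta s / s `^ p], whatever the space.

    For [s >= 1] the profile is the affine function [alpha * (s - 1) + beta], so
    one looks for the smallest multiple of the convex function [s `^ p] above
    this line on the half-line [s >= 1].  If [alpha > p * beta], one multiple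
    has the line as its tangent, at the point
    [s0 = p * (alpha - beta) / ((p - 1) * alpha) > 1]; the second formula for
    [clip_K] is this multiple ([clip_K_contact_point]), and the tangent lies
    below the curve by Bernoulli's inequality at [s / s0] ([bernoulli_powR]).
    If [alpha <= p * beta], the line is at most [beta * (1 + p * (s - 1))], the
    tangent of [beta * s `^ p] at [s = 1], and Bernoulli's inequality applies at
    [s] itself.  Either way the line lies below [clip_K p alpha beta * s `^ p]
    ([affine_le_clip_K]).

    At [s = 1] this gives [beta <= clip_K p alpha beta], which settles [s <= 1],
    as [s ^+ 2 <= s `^ p] there for [p <= 2].  Equality at [s = 1], resp. at
    [s = s0], gives optimality ([clip_K_attained]). *)

(** * The one-variable inequality *)

(** Writing [t `^ p = t * expR ((p - 1) * ln t)], the bound [1 + u <= expR u]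
    reduces the claim to [t - 1 <= t * ln t], which is [ln y <= y - 1] at
    [y = t^-1]. *)
Lemma bernoulli_powR (R : realType) (p t : R) :
  1 <= p -> 0 <= t -> 1 + p * (t - 1) <= t `^ p.
Proof.
move=> p1; rewrite le_eqVlt => /predU1P[<-|t0].
  by rewrite powR0 ?gt_eqF//; lra.
have tln : t - 1 <= t * ln t.
  have : ln t^-1 <= t^-1 - 1.
    have := @le_ln1Dx R (t^-1 - 1).
    rewrite addrCA subrr addr0; apply.
    by rewrite ltrBrDr addNr invr_gt0.
  rewrite lnV ?posrE// -(ler_pM2l t0) mulrBr divff ?gt_eqF//; lra.
have -> : t `^ p = t * expR ((p - 1) * ln t).
  rewrite -{2}(lnK t0) -expRD /powR gt_eqF//; congr expR; ring.
have := expR_ge1Dx ((p - 1) * ln t).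
rewrite -(ler_pM2l t0); nra.
Qed.

(** The abscissa at which the line [alpha * (s - 1) + beta] touches
    [clip_K p alpha beta * s `^ p] when [p * beta < alpha]. *)
Definition contact_point (R : realType) (p alpha beta : R) : R :=
  p * (alpha - beta) / ((p - 1) * alpha).

Lemma contact_point_gt1 (R : realType) (p alpha beta : R) :
  1 < p -> 0 <= beta -> p * beta < alpha -> 1 < contact_point p alpha beta.
Proof.
move=> p1 b0 ba; have a0 : 0 < alpha by nra.
rewrite /contact_point ltr_pdivlMr; last by rewrite mulr_gt0// subr_gt0.
nra.
Qed.

(** [clip_c] is the constant for which all powers cancel here.  With this value
    at [s0 = contact_point p alpha beta], the tangent of the curve
    [clip_K p alpha beta * s `^ p] at [s0] has slope
    [p / s0 * ((alpha - beta) / (p - 1)) = alpha] and meets the axis [s = 0] at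
    height [- (alpha - beta)]: it is the line [alpha * (s - 1) + beta]. *)
Lemma clip_K_contact_point (R : realType) (p alpha beta : R) :
  1 < p -> 0 <= beta -> p * beta < alpha ->
  clip_K p alpha beta * contact_point p alpha beta `^ p
    = (alpha - beta) / (p - 1).
Proof.
move=> p1 b0 ba.
have a0 : 0 < alpha by nra.
have d0 : 0 < alpha - beta by nra.
have q0 : 0 < p - 1 by lra.
have p0 : 0 < p by lra.
have powRB1 (y : R) : 0 < y -> y `^ p = y `^ (p - 1) * y.
  move=> y0; rewrite -{3}(powRr1 (ltW y0)) -powRD ?subrK//.
  by rewrite gt_eqF ?implybT.
have powRV (y : R) : 0 <= y -> y^-1 `^ p = (y `^ p)^-1.
  by move=> y0; rewrite -(powR_inv1 y0) -powRrM mulN1r powRN.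
rewrite /clip_K leNgt ba /= /clip_c /contact_point.
rewrite powRM ?invr_ge0 ?mulr_ge0 ?(ltW p0) ?(ltW d0) ?(ltW q0) ?(ltW a0)//.
rewrite powRM ?(ltW p0) ?(ltW d0)//.
rewrite powRV ?mulr_ge0 ?(ltW q0) ?(ltW a0)//.
rewrite powRM ?(ltW q0) ?(ltW a0)// (powRB1 _ q0) (powRB1 _ d0).
have := powR_gt0 p q0; have := powR_gt0 (p - 1) q0; have := powR_gt0 p p0.
have := powR_gt0 p a0; have := powR_gt0 (p - 1) d0.
move: (alpha `^ p) (p `^ p) ((p - 1) `^ (p - 1)) ((alpha - beta) `^ (p - 1)).
move=> A B C D D0 A0 B0 C0 _.
by field; rewrite ?gt_eqF.
Qed.

(** The line is below the tangent of the curve, at [s = 1] if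
    [alpha <= p * beta] and at [contact_point p alpha beta] otherwise, and
    Bernoulli's inequality puts that tangent below the curve. *)
Lemma affine_le_clip_K (R : realType) (p alpha beta s : R) :
  1 < p -> 0 <= beta -> 1 <= s ->
  alpha * (s - 1) + beta <= clip_K p alpha beta * s `^ p.
Proof.
move=> p1 b0 s1; have s0 : 0 <= s by lra.
have [ab|ba] := leP alpha (p * beta).
  rewrite /clip_K ab.
  have := ler_wpM2l b0 (bernoulli_powR (ltW p1) s0); nra.
have a0 : 0 < alpha by nra.
have q0 : 0 < p - 1 by lra.
have c0 : 0 < contact_point p alpha beta.
  exact: lt_trans ltr01 (contact_point_gt1 p1 b0 ba).
have cN0 : contact_point p alpha beta != 0 by rewrite gt_eqF.
rewrite -[X in X `^ p](divfK cN0).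
have sc0 := divr_ge0 s0 (ltW c0).
rewrite (powRM p sc0 (ltW c0)) mulrCA clip_K_contact_point// [leRHS]mulrC.
have d0 : 0 <= (alpha - beta) / (p - 1) by rewrite divr_ge0//; nra.
have := bernoulli_powR (ltW p1) sc0.
move=> /(ler_wpM2l d0); apply: le_trans.
rewrite /contact_point le_eqVlt; apply/orP; left; apply/eqP.
field; rewrite !gt_eqF//; nra.
Qed.

Lemma le_clip_K (R : realType) (p alpha beta : R) :
  1 < p -> 0 <= beta -> beta <= clip_K p alpha beta.
Proof.
move=> p1 b0; have := @affine_le_clip_K R p alpha beta 1 p1 b0 (lexx 1).
by rewrite subrr mulr0 add0r powR1 mulr1.
Qed.

(** What the left side of the theorem becomes for [tau = 1], at a vector of
    norm [s]. *)
Definition clip_profile (R : realType) (alpha beta s : R) : R :=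
  if s <= 1 then beta * s ^+ 2 else alpha * (s - 1) + beta.

Lemma clip_profile_ge1 (R : realType) (alpha beta s : R) :
  1 <= s -> clip_profile alpha beta s = alpha * (s - 1) + beta.
Proof.
rewrite /clip_profile; case: ifPn => // s1 s1'.
have -> : s = 1 by apply/eqP; rewrite eq_le s1.
by rewrite expr1n subrr mulr0 add0r mulr1.
Qed.

Lemma clip_profile_le (R : realType) (p alpha beta s : R) :
  1 < p -> p <= 2 -> 0 <= beta -> 0 <= s ->
  clip_profile alpha beta s <= clip_K p alpha beta * s `^ p.
Proof.
move=> p1 p2 b0 s0.
have [s1|s1] := leP 1 s; first by rewrite clip_profile_ge1// affine_le_clip_K.
rewrite /clip_profile (ltW s1); apply: ler_pM; rewrite ?sqr_ge0 ?le_clip_K//.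
rewrite -powR_mulrn//; move: s0; rewrite le_eqVlt => /predU1P[<-|s0].
  by rewrite !powR0// gt_eqF//; lra.
by apply: ger_powR => //; rewrite s0 ltW.
Qed.

(** The line and the curve meet at [s = 1] if [alpha <= p * beta], since
    [clip_K p alpha beta] is then [beta], and at [contact_point p alpha beta]
    otherwise.  Both abscissae are at least [1], where the profile follows the
    line. *)
Lemma clip_K_attained (R : realType) (p alpha beta : R) :
  1 < p -> 0 <= beta ->
  exists2 s, 1 <= s & clip_profile alpha beta s = clip_K p alpha beta * s `^ p.
Proof.
move=> p1 b0; have [ab|ba] := leP alpha (p * beta).
  exists 1 => //; rewrite clip_profile_ge1// subrr mulr0 add0r powR1 mulr1.
  by rewrite /clip_K ab.
have c1 := contact_point_gt1 p1 b0 ba.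
exists (contact_point p alpha beta); first exact: ltW.
rewrite clip_profile_ge1 ?(ltW c1)// clip_K_contact_point// /contact_point.
by field; rewrite !gt_eqF//; nra.
Qed.

(** * Reduction to one variable *)

Lemma clip_profileE (R : realType) (E : normedModType R)
    (tau alpha beta : R) (x : E) :
  0 < tau ->
  alpha * `|x - radial_clip tau x| + beta / tau * `|radial_clip tau x| ^+ 2
    = tau * clip_profile alpha beta (`|x| / tau).
Proof.
move=> t0; rewrite /radial_clip /clip_profile ler_pdivrMr// mul1r.
case: leP => [_|tx].
  by rewrite subrr normr0; field; rewrite gt_eqF.
have x0 : 0 < `|x| := lt_trans t0 tx.
have -> : `|(tau / `|x|) *: x| = tau.
  by rewrite normrZ ger0_norm ?divr_ge0 ?(ltW t0)// divfK// gt_eqF.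
have -> : `|x - (tau / `|x|) *: x| = `|x| - tau.
  rewrite -{1}[x]scale1r -scalerBl normrZ ger0_norm.
    by rewrite mulrBl mul1r divfK// gt_eqF.
  by rewrite subr_ge0 ler_pdivrMr// mul1r ltW.
by field; rewrite gt_eqF.
Qed.

Lemma powR_rescale (R : realType) (p tau r : R) :
  0 < tau -> 0 <= r -> tau `^ (1 - p) * r `^ p = tau * (r / tau) `^ p.
Proof.
move=> t0 r0; have tN0 : tau != 0 by rewrite gt_eqF.
have rt0 := divr_ge0 r0 (ltW t0).
rewrite -[in LHS](divfK tN0 r) (powRM p rt0 (ltW t0)) mulrCA -powRD.
  by rewrite subrK powRr1 ?(ltW t0)// mulrC.
by rewrite tN0 implybT.
Qed.

Lemma exists_norm_eq (R : realType) (E : normedModType R) (v : E) (r : R) :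
  v != 0 -> 0 <= r -> exists x : E, `|x| = r.
Proof.
move=> v0 r0; exists ((r / `|v|) *: v).
by rewrite normrZ ger0_norm ?divr_ge0// divfK// normr_eq0.
Qed.

Theorem theorem2p1 (R : realType) (p alpha beta : R)
    (hp1 : 1 < p) (hp2 : p <= 2) (halpha : 0 <= alpha) (hbeta : 0 <= beta) :
  (forall (E : normedModType R), (exists v : E, v != 0) ->
   forall tau : R, 0 < tau ->
   forall x : E,
     alpha * `|x - radial_clip tau x| + beta / tau * `|radial_clip tau x| ^+ 2
       <= clip_K p alpha beta * tau `^ (1 - p) * `|x| `^ p)
  /\
  (forall (E : normedModType R), (exists v : E, v != 0) ->
   forall tau : R, 0 < tau ->
   forall K : R,
     (forall x : E,
        alpha * `|x - radial_clip tau x|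
          + beta / tau * `|radial_clip tau x| ^+ 2
          <= K * tau `^ (1 - p) * `|x| `^ p) ->
     clip_K p alpha beta <= K).
Proof.
split=> E [v v0] tau t0.
  move=> x; rewrite clip_profileE// -mulrA powR_rescale// mulrCA ler_pM2l//.
  by rewrite clip_profile_le// divr_ge0 // ltW.
move=> K HK; have [s s1 sE] := clip_K_attained alpha hp1 hbeta.
have s0 : 0 < s by lra.
have [x xE] := exists_norm_eq v0 (mulr_ge0 (ltW s0) (ltW t0)).
have := HK x; rewrite clip_profileE// -mulrA powR_rescale// mulrCA ler_pM2l//.
by rewrite xE mulfK ?gt_eqF// sE ler_pM2r// powR_gt0.
Qed.
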